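(* Let $p\in\mathbb{C}^4$. There are one-to-one correspondences between the following quantities: (QP1) $\alpha$-planes $\Pi_p\subset T_p\mathbb{C}^4$; (QP2) positive almost Hermitian structures $J_p:T_p\mathbb{R}^4_p\to T_p\mathbb{R}^4_p$; (QP3) unit vectors $U_p\in T_p\mathbb{R}^3_p$; (QP4) null directions $W_p\subset T_p\mathbb{M}^4_p$; given by: - $J_p(\Pi_p)$ is the endomorphism equal to $-i$ on $\Pi_p$ and $+i$ on $\overline{\Pi}_p$; inversely $\Pi_p(J_p)=\{X+iJ_pX: X\in T_p\mathbb{R}^4_p\}$, the $(0,1)$-tangent space of $J_p$; - $U_p(J_p)=J_p(\partial/\partial x_0)$; inversely $J_p(U_p)$ is the unique positive almost Hermitian structure at $p$ with $J_p(\partial/\partial x_0)=U_p$; - $W_p(U_p)=\mathrm{span}\{\partial/\partial t+U_p\}$; inversely $U_p(W_p)$ is the unique unit vector $U_p\in T_p\mathbb{R}^3_p$ such that $W_p=\mathrm{span}\{\partial/\partial t+U_p\}$; - $W_p(\Pi_p)=\Pi_p\cap T_p\mathbb{M}^4_p$; inversely $\Pi_p(W_p)$ is the unique $\alpha$-plane containing $W_p$.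
   Context: $\mathbb{C}^4=\{(x_0,x_1,x_2,x_3)\}$ carries the holomorphic metric $g^{\mathrm C}=dx_0^2+dx_1^2+dx_2^2+dx_3^2$ (complex-bilinear). For $p=(p_0,\dots,p_3)\in\mathbb{C}^4$ the slices through $p$ are: $\mathbb{R}^4_p=\{p+(x_0,x_1,x_2,x_3):x_i\in\mathbb{R}\}$, with Euclidean metric and standard orientation; $\mathbb{R}^3_p=\{p+(0,x_1,x_2,x_3):x_i\in\mathbb{R}\}$; $\mathbb{M}^4_p=\{p+(-it,x_1,x_2,x_3):t,x_i\in\mathbb{R}\}$, on which $g^{\mathrm C}$ restricts to the Minkowski metric $-dt^2+dx_1^2+dx_2^2+dx_3^2$ (thus $\partial/\partial t=-i\,\partial/\partial x_0$). $T_p\mathbb{C}^4$ is identified with $T_p\mathbb{R}^4_p\otimes\mathbb{C}$; the bar denotes conjugation with respect to this real structure. An $\alpha$-plane at $p$ is a complex $2$-dimensional subspace $\mathrm{span}\{e_0+ie_1,e_2+ie_3\}$ of $T_p\mathbb{C}^4$, where $\{e_0,e_1,e_2,e_3\}$ is a positively oriented orthonormal basis of $T_p\mathbb{R}^4_p$. An almost Hermitian structure $J_p$ at $p$ is an isometric linear endomorphism with $J_p^2=-I$; it is positive if there is a positively oriented orthonormal basis with $J_pe_0=e_1$, $J_pe_2=e_3$. A null direction is a real one-dimensional subspace of $T_p\mathbb{M}^4_p$ spanned by a non-zero null vector. *)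

(* Defs.v *)
From HB Require Import structures.
From mathcomp Require Import all_boot all_order all_algebra.
From mathcomp Require Import complex.
From mathcomp Require Import mathcomp_extra boolp classical_sets functions reals.

Set Implicit Arguments.
Unset Strict Implicit.
Unset Printing Implicit Defensive.

Import Order.TTheory GRing.Theory Num.Theory.

Local Open Scope classical_set_scope.
Local Open Scope ring_scope.
Local Open Scope complex_scope.

(* C^4 is 'rV[R[i]]_4 for R : realType, and each T_p C^4 is identified with it
   by translation.  T_p R^4_p is represented by 'rV[R]_4, sitting inside
   T_p C^4 through [cvec] (see [tangent_slice_R4]). *)

(* dx_0^2 + dx_1^2 + dx_2^2 + dx_3^2: over R[i] the complex-bilinear metric,
   over R its restriction, the Euclidean metric of T_p R^4_p. *)
Definition metric (K : comNzRingType) (u v : 'rV[K]_4) : K :=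
  \sum_(j < 4) u 0 j * v 0 j.

Definition cvec (R : realType) (x : 'rV[R]_4) : 'rV[R[i]]_4 :=
  \row_j (x 0 j)%:C.

(* (t, x1, x2, x3) |-> (-it, x1, x2, x3) *)
Definition wick (R : realType) (x : 'rV[R]_4) : 'rV[R[i]]_4 :=
  \row_j (if j == 0 then - 'i * (x 0 j)%:C else (x 0 j)%:C).

Section Slices.
Variables (R : realType) (p : 'rV[R[i]]_4).

Definition slice_R4 : set 'rV[R[i]]_4 := [set p + cvec x | x in setT].

Definition slice_R3 : set 'rV[R[i]]_4 :=
  [set p + cvec x | x in [set x : 'rV[R]_4 | x 0 0 = 0]].

Definition slice_M4 : set 'rV[R[i]]_4 := [set p + wick x | x in setT].

(* Tangent space at p of a real affine subspace S through p. *)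
Definition tangent (S : set 'rV[R[i]]_4) : set 'rV[R[i]]_4 :=
  [set v | S (p + v)].

Lemma tangent_slice_R4 : tangent slice_R4 = range (@cvec R).
Proof.
apply/seteqP; split => v /= [x _].
  by move=> /addrI <-; exists x.
by move=> <-; exists x.
Qed.

End Slices.

Section TangentVectors.
Variable R : realType.
Implicit Types (v : 'rV[R[i]]_4) (Pi W : set 'rV[R[i]]_4).
Implicit Types (J : 'End('rV[R]_4)) (X U : 'rV[R]_4).

Definition d_x0 : 'rV[R]_4 := delta_mx 0 0.

Definition d_t : 'rV[R[i]]_4 := - 'i *: cvec d_x0.

Lemma d_tE : d_t = wick d_x0.
Proof.
apply/rowP => j; rewrite !mxE eqxx /=.
by case: eqP => //= _; rewrite mulr0.
Qed.

Lemma metric_wick (x : 'rV[R]_4) :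
  metric (wick x) (wick x) =
  (- x 0 0 ^+ 2 + x 0 1 ^+ 2 + x 0 2 ^+ 2 + x 0 3 ^+ 2)%:C.
Proof.
rewrite /metric !big_ord_recl big_ord0 !mxE /=.
have -> : lift ord0 ord0 = 1 :> 'I_4 by apply/val_inj.
have -> : lift ord0 (lift ord0 ord0) = 2 :> 'I_4 by apply/val_inj.
have -> : lift ord0 (lift ord0 (lift ord0 ord0)) = 3 :> 'I_4 by apply/val_inj.
by apply/eqP; rewrite eq_complex /= !expr2; apply/andP; split; apply/eqP;
  rewrite !(mulr0, mul0r, addr0, add0r, subr0, sub0r, mulr1, mul1r, oppr0,
            mulNr, mulrN, opprK) ?addrA.
Qed.

Definition conj_vec v : 'rV[R[i]]_4 := map_mx (@conjc R) v.

(* The complex-linear extension of J to T_p C^4. *)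
Definition complexify J v : 'rV[R[i]]_4 :=
  cvec (J (map_mx (@complex.Re R) v)) + 'i *: cvec (J (map_mx (@complex.Im R) v)).

(* The rows of E form a positively oriented orthonormal basis. *)
Definition oriented_orthonormal (E : 'M[R]_4) : Prop :=
  (forall i j, metric (row i E) (row j E) = (i == j)%:R) /\ 0 < \det E.

Definition complex_span2 (a b : 'rV[R[i]]_4) : set 'rV[R[i]]_4 :=
  [set v | v \in <<[:: a; b]>>%VS].

Definition alpha_plane Pi : Prop :=
  exists2 E : 'M[R]_4, oriented_orthonormal E &
    Pi = complex_span2 (cvec (row 0 E) + 'i *: cvec (row 1 E))
                       (cvec (row 2 E) + 'i *: cvec (row 3 E)).

Definition almost_hermitian J : Prop :=
  (forall X Y, metric (J X) (J Y) = metric X Y) /\ (forall X, J (J X) = - X).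

Definition positive_almost_hermitian J : Prop :=
  almost_hermitian J /\
  exists2 E : 'M[R]_4, oriented_orthonormal E &
    J (row 0 E) = row 1 E /\ J (row 2 E) = row 3 E.

Definition real_span v : set 'rV[R[i]]_4 := [set r%:C *: v | r in setT].

Definition unit_vector_R3 (p : 'rV[R[i]]_4) U : Prop :=
  tangent p (slice_R3 p) (cvec U) /\ metric U U = 1.

Definition null_direction (p : 'rV[R[i]]_4) W : Prop :=
  exists w, [/\ tangent p (slice_M4 p) w, w != 0, metric w w = 0
              & W = real_span w].

(* J is -i on Pi and +i on the conjugate plane. *)
Definition eigen_mi_pi Pi J : Prop :=
  (forall v, Pi v -> complexify J v = - 'i *: v) /\
  (forall v, (conj_vec @` Pi) v -> complexify J v = 'i *: v).

Definition plane_of_J J : set 'rV[R[i]]_4 :=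
  [set cvec X + 'i *: cvec (J X) | X in setT].

Definition vector_of_J J : 'rV[R]_4 := J d_x0.

Definition direction_of_vector U : set 'rV[R[i]]_4 :=
  real_span (d_t + cvec U).

Definition direction_of_plane (p : 'rV[R[i]]_4) Pi : set 'rV[R[i]]_4 :=
  Pi `&` tangent p (slice_M4 p).

End TangentVectors.

Definition one_to_one (T U : Type) (A : set T) (B : set U)
    (f : T -> U) (g : U -> T) : Prop :=
  [/\ set_bij A B f, set_bij B A g, {in A, cancel f g} & {in B, cancel g f}].

(* Main.v *)
Require Import Defs.
From HB Require Import structures.
From mathcomp Require Import all_boot all_order all_algebra.
From mathcomp Require Import complex.
From mathcomp Require Import mathcomp_extra boolp classical_sets functions reals.
From mathcomp Require Import ring lra.

Set Implicit Arguments.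
Unset Strict Implicit.
Unset Printing Implicit Defensive.

Import Order.TTheory GRing.Theory Num.Theory.

Local Open Scope classical_set_scope.
Local Open Scope ring_scope.
Local Open Scope complex_scope.

(* All four families are parametrized by the unit vectors U of R^3.  The
   antisymmetric 4x4 matrices A with A^2 = -1 are self-dual or anti-self-dual
   according to the sign of their Pfaffian.  A positive almost Hermitian
   structure is E^T K E with E in SO(4) and K standard, and
   Pf(E^T K E) = det E Pf K = 1, so it is self-dual, hence determined by its
   first row U; an adapted frame of the self-dual matrix of U is (d_x0, U, V, JV)
   with V a unit vector orthogonal to d_x0 and U.  The alpha-plane of J is
   {X + iJX}, and X + iJX lies in the Minkowski slice exactly when X is a real
   multiple of U = J d_x0, where it is a multiple of d_t + U. *)

(** * Coordinate algebra: 4x4 determinant, Pfaffian, self-dual matrices *)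

Section Coordinates.
Variable K : comNzRingType.

Lemma ord4P (P : 'I_4 -> Prop) : P 0 -> P 1 -> P 2 -> P 3 -> forall i, P i.
Proof.
move=> P0 P1 P2 P3 [[|[|[|[|//]]]] i4].
- by rewrite (_ : Ordinal _ = 0) //; apply/val_inj.
- by rewrite (_ : Ordinal _ = 1) //; apply/val_inj.
- by rewrite (_ : Ordinal _ = 2) //; apply/val_inj.
- by rewrite (_ : Ordinal _ = 3) //; apply/val_inj.
Qed.

Lemma sum_ord4 (V : nmodType) (F : 'I_4 -> V) :
  \sum_(j < 4) F j = F 0 + F 1 + F 2 + F 3.
Proof.
rewrite !big_ord_recr big_ord0 /= add0r.
by congr (F _ + F _ + F _ + F _); apply/val_inj.
Qed.

(** Entries are indexed by [nat] so that the [bump] indices left by the cofactor expansions compute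
    to numerals. *)
Lemma det_matrix4 (f : nat -> nat -> K) :
  \det (\matrix_(i < 4, j < 4) f i j) =
    f 0 0 * (f 1 1 * (f 2 2 * f 3 3 - f 2 3 * f 3 2)
           - f 1 2 * (f 2 1 * f 3 3 - f 2 3 * f 3 1)
           + f 1 3 * (f 2 1 * f 3 2 - f 2 2 * f 3 1))
  - f 0 1 * (f 1 0 * (f 2 2 * f 3 3 - f 2 3 * f 3 2)
           - f 1 2 * (f 2 0 * f 3 3 - f 2 3 * f 3 0)
           + f 1 3 * (f 2 0 * f 3 2 - f 2 2 * f 3 0))
  + f 0 2 * (f 1 0 * (f 2 1 * f 3 3 - f 2 3 * f 3 1)
           - f 1 1 * (f 2 0 * f 3 3 - f 2 3 * f 3 0)
           + f 1 3 * (f 2 0 * f 3 1 - f 2 1 * f 3 0))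
  - f 0 3 * (f 1 0 * (f 2 1 * f 3 2 - f 2 2 * f 3 1)
           - f 1 1 * (f 2 0 * f 3 2 - f 2 2 * f 3 0)
           + f 1 2 * (f 2 0 * f 3 1 - f 2 1 * f 3 0)) :> K.
Proof.
do 3 rewrite !(expand_det_row _ 0) !big_ord_recr !big_ord0 /= /cofactor !mxE /=.
rewrite !det_mx11 !mxE /= /bump /=.
ring.
Qed.

Definition pfaffian4 (A : 'M[K]_4) : K :=
  A 0 1 * A 2 3 - A 0 2 * A 1 3 + A 0 3 * A 1 2.

(* Acting on row vectors this is a multiplication by the imaginary quaternion
   u, on the side which maps d_x0 to u and, for u = d_x1, d_x2 to d_x3. *)
Definition selfdual_mx (u : 'rV[K]_4) : 'M[K]_4 :=
  \matrix_(i, j) nth 0 (nth [::]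
    [:: [::      0;     u 0 1;     u 0 2;     u 0 3];
        [:: - u 0 1;        0;     u 0 3;   - u 0 2];
        [:: - u 0 2;  - u 0 3;         0;     u 0 1];
        [:: - u 0 3;    u 0 2;   - u 0 1;         0]] i) j.

Definition d_x1 : 'rV[K]_4 := delta_mx 0 1.

(** [selfdual_mx d_x1] is the standard 2-form e_0 /\ e_1 + e_2 /\ e_3; the congruence is the same
    form in the rows of [E]. *)
Lemma congr_selfdual_mx_d_x1 (E : 'M[K]_4) i j :
  (E^T *m selfdual_mx d_x1 *m E) i j =
  E 0 i * E 1 j - E 1 i * E 0 j + (E 2 i * E 3 j - E 3 i * E 2 j).
Proof.
have colE k : (E^T *m selfdual_mx d_x1) i k =
    E 0 i * selfdual_mx d_x1 0 k + E 1 i * selfdual_mx d_x1 1 k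
    + E 2 i * selfdual_mx d_x1 2 k + E 3 i * selfdual_mx d_x1 3 k.
  by rewrite mxE sum_ord4 ![E^T _ _]mxE.
by rewrite mxE sum_ord4 !colE !mxE /=; ring.
Qed.

(** Instance of Pf(E^T A E) = det E Pf A with Pf A = 1, a polynomial identity in the entries of
    [E]. *)
Lemma pfaffian_congr (E : 'M[K]_4) :
  pfaffian4 (E^T *m selfdual_mx d_x1 *m E) = \det E.
Proof.
(* [inord] re-indexes [E] by naturals, as [det_matrix4] expects. *)
have -> : \det E = \det (\matrix_(i < 4, j < 4) E (inord i) (inord j)).
  by congr (\det _); apply/matrixP => i j; rewrite mxE !inord_val.
rewrite (det_matrix4 (fun i j => E (inord i) (inord j))).
have -> : inord 0 = 0 :> 'I_4 by apply/val_inj; rewrite val_insubd.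
have -> : inord 1 = 1 :> 'I_4 by apply/val_inj; rewrite val_insubd.
have -> : inord 2 = 2 :> 'I_4 by apply/val_inj; rewrite val_insubd.
have -> : inord 3 = 3 :> 'I_4 by apply/val_inj; rewrite val_insubd.
rewrite /pfaffian4 !congr_selfdual_mx_d_x1; ring.
Qed.

Lemma selfdual_mx_tr (u : 'rV[K]_4) : (selfdual_mx u)^T = - selfdual_mx u.
Proof.
by apply/matrixP; elim/ord4P; elim/ord4P; rewrite !mxE /= ?oppr0 ?opprK.
Qed.

(** This is u^2 = - |u|^2 for an imaginary quaternion u. *)
Lemma selfdual_mx_sqr (u : 'rV[K]_4) : u 0 0 = 0 -> metric u u = 1 ->
  selfdual_mx u *m selfdual_mx u = - 1%:M.
Proof.
rewrite /metric sum_ord4 => -> u1; apply/matrixP.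
(* [u1] read backwards turns 1 into the sum of squares, leaving polynomial identities. *)
elim/ord4P; elim/ord4P; rewrite !(mxE, sum_ord4) /= -?u1; ring.
Qed.

Lemma pfaffian_selfdual_mx (u : 'rV[K]_4) : u 0 0 = 0 ->
  pfaffian4 (selfdual_mx u) = metric u u.
Proof. by move=> u0; rewrite /metric sum_ord4 u0 /pfaffian4 !mxE /=; ring. Qed.

Lemma metricE (u v : 'rV[K]_4) : metric u v = (u *m v^T) 0 0.
Proof. by rewrite mxE; apply: eq_bigr => j _; rewrite mxE. Qed.

Lemma metricC (u v : 'rV[K]_4) : metric u v = metric v u.
Proof. by apply: eq_bigr => j _; rewrite mulrC. Qed.

Lemma delta_selfdual_mx (u : 'rV[K]_4) : u 0 0 = 0 ->
  delta_mx 0 0 *m selfdual_mx u = u.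
Proof.
by move=> u0; rewrite -rowE; apply/rowP; elim/ord4P; rewrite !mxE.
Qed.

End Coordinates.

(** * Self-duality from a unit Pfaffian *)

Section SelfDual.
Variable R : realFieldType.

(* With Pf A = 1 and tr A^2 = -4, the squares of the anti-self-dual components
   a01 - a23, a02 + a13, a03 - a12 add up to 2 - 2 Pf A = 0. *)
Lemma selfdual_mxP (A : 'M[R]_4) : A^T = - A -> A *m A = - 1%:M ->
  pfaffian4 A = 1 -> A = selfdual_mx (row 0 A).
Proof.
move=> AT A2 Pf.
have sw i j : A i j = - A j i by have /matrixP/(_ j i) := AT; rewrite !mxE.
have d0 i : A i i = 0 by have := sw i i; lra.
have tr i : \sum_j A i j * A j i = - 1.
  by have /matrixP/(_ i i) := A2; rewrite !mxE eqxx.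
have := tr 0; have := tr 1; have := tr 2; have := tr 3.
rewrite !sum_ord4 !d0 (sw 1 0) (sw 2 0) (sw 3 0) (sw 2 1) (sw 3 1) (sw 3 2).
move: Pf; rewrite /pfaffian4 => Pf t3 t2 t1 t0.
have sq : (A 0 1 - A 2 3) ^+ 2 + (A 0 2 + A 1 3) ^+ 2 + (A 0 3 - A 1 2) ^+ 2 = 0.
  lra.
move/eqP: sq; rewrite !paddr_eq0 ?addr_ge0 ?sqr_ge0 // !sqrf_eq0 !subr_eq0 addr_eq0.
move=> /andP[/andP[/eqP E1 /eqP E2] /eqP E3].
apply/matrixP; elim/ord4P; elim/ord4P; rewrite ?mxE /= ?mxE ?d0 //.
all: by rewrite ?E1 ?E2 ?E3 ?opprK // sw.
Qed.

End SelfDual.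

(** * Oriented orthonormal frames and self-dual matrices *)

Section Frames.
Variable R : realType.
Implicit Types (E : 'M[R]_4) (U X Y : 'rV[R]_4) (J : 'End('rV[R]_4)).

Definition unit_R3 U : Prop := U 0 0 = 0 /\ metric U U = 1.

Lemma orthonormal_mulmx E :
  (forall i j, metric (row i E) (row j E) = (i == j)%:R) -> E *m E^T = 1%:M.
Proof.
move=> orthE; apply/matrixP => i j; rewrite [RHS]mxE -orthE mxE.
by apply: eq_bigr => k _; rewrite !mxE.
Qed.

Lemma oriented_orthonormal_mulmx E :
  oriented_orthonormal E -> E *m E^T = 1%:M /\ \det E = 1.
Proof.
move=> [orthE detE].
have EE := orthonormal_mulmx orthE.
split=> //; have /eqP := congr1 determinant EE.
rewrite det_mulmx det_tr det1 -expr2 sqrf_eq1 => /orP[/eqP //|/eqP dN1].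
by move: detE; rewrite dN1 ltr0N1.
Qed.

(** The congruent matrix is antisymmetric with square -1 and Pfaffian [\det E] = 1, so
    [selfdual_mxP] applies. *)
Lemma congr_oriented E : oriented_orthonormal E ->
  exists2 U, unit_R3 U & E^T *m selfdual_mx (d_x1 R) *m E = selfdual_mx U.
Proof.
move=> /oriented_orthonormal_mulmx[EE detE].
set M := _ *m E; have MT : M^T = - M.
  by rewrite !trmx_mul trmxK selfdual_mx_tr mulNmx mulmxN mulmxA.
have d1 : (d_x1 R) 0 0 = 0 /\ metric (d_x1 R) (d_x1 R) = 1.
  by rewrite /metric sum_ord4 !mxE /= !(mulr0, mulr1, add0r, addr0).
have MM : M *m M = - 1%:M.
  rewrite /M -!mulmxA (mulmxA E) EE mul1mx (mulmxA (selfdual_mx _)).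
  by rewrite selfdual_mx_sqr; case: d1 => // _ _; rewrite
     mulNmx mul1mx mulmxN (mulmx1C EE).
have MU : M = selfdual_mx (row 0 M).
  by apply: selfdual_mxP => //; rewrite pfaffian_congr.
(* The squared norm of row 0 is the Pfaffian of [M], that is [\det E] = 1. *)
exists (row 0 M) => //; have M0 : row 0 M 0 0 = 0 by rewrite mxE MU mxE.
by split=> //; rewrite -pfaffian_selfdual_mx // -MU pfaffian_congr.
Qed.

Lemma exists_orthogonal_unit_R3 U : unit_R3 U ->
  exists2 V, unit_R3 V & metric U V = 0.
Proof.
move=> [U0 U1].
(* Divides a vector (0, a, b, c) orthogonal to [U] by s, where s^2 is its squared norm. *)
have mk (a b c s : R) : s != 0 -> s ^+ 2 = a ^+ 2 + b ^+ 2 + c ^+ 2 ->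
    U 0 1 * a + U 0 2 * b + U 0 3 * c = 0 ->
    exists2 V, unit_R3 V & metric U V = 0.
  move=> s0 sE UV.
  exists (s^-1 *: \row_j nth 0 [:: 0; a; b; c] j); first split.
  - by rewrite !mxE mulr0.
  - rewrite /metric sum_ord4 !mxE /=.
    transitivity (s^-1 ^+ 2 * (a ^+ 2 + b ^+ 2 + c ^+ 2)); first by ring.
    by rewrite -sE exprVn mulVf // sqrf_eq0.
  - rewrite /metric sum_ord4 !mxE /= U0.
    transitivity (s^-1 * (U 0 1 * a + U 0 2 * b + U 0 3 * c)); first by ring.
    by rewrite UV mulr0.
(* On the x_3 axis, [U] is orthogonal to d_x1; elsewhere (0, U_2, -U_1, 0) is non-zero and
   orthogonal to [U]. *)
have [/eqP|n0] := eqVneq (U 0 1 ^+ 2 + U 0 2 ^+ 2) 0.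
  rewrite paddr_eq0 ?sqr_ge0 // !sqrf_eq0 => /andP[/eqP u1 /eqP u2].
  by apply: (mk 1 0 0 1); rewrite ?oner_eq0 // ?u1 ?u2; ring.
apply: (mk (U 0 2) (- U 0 1) 0 (Num.sqrt (U 0 1 ^+ 2 + U 0 2 ^+ 2))).
- by rewrite sqrtr_eq0 -ltNge lt_def n0 addr_ge0 ?sqr_ge0.
- by rewrite sqr_sqrtr ?addr_ge0 ?sqr_ge0 //; ring.
- by ring.
Qed.

Lemma selfdual_mx_frame U : unit_R3 U ->
  exists2 E, oriented_orthonormal E &
    E^T *m selfdual_mx (d_x1 R) *m E = selfdual_mx U.
Proof.
move=> Uu; have [V [V0 VV] UV] := exists_orthogonal_unit_R3 Uu.
case: (Uu) => U0 UU; set A := selfdual_mx U.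
have AA : A *m A = - 1%:M by apply: selfdual_mx_sqr.
(* [A] is skew-adjoint, hence by A^2 = -1 an isometry; this yields the inner products of the
   frame. *)
have mA X Y : metric X (Y *m A) = - metric (X *m A) Y.
  by rewrite !metricE trmx_mul selfdual_mx_tr mulNmx mulmxN mulmxA mxE.
have mAA X Y : metric (X *m A) (Y *m A) = metric X Y.
  by rewrite mA -mulmxA AA mulmxN mulmx1 !metricE mulNmx mxE opprK.
have mx0 X : metric X (X *m A) = 0.
  by have := mA X X; rewrite [in RHS]metricC; lra.
have e0A : d_x0 R *m A = U by apply: delta_selfdual_mx.
have e0 X : metric (d_x0 R) X = X 0 0.
  by rewrite /metric sum_ord4 !mxE /= !(mul0r, mul1r, addr0).
have UA X : metric U (X *m A) = X 0 0 by rewrite -e0A mAA e0.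
have e0VA : metric (d_x0 R) (V *m A) = 0 by rewrite mA e0A UV oppr0.
pose E : 'M[R]_4 := \matrix_i nth 0 [:: d_x0 R; U; V; V *m A] i.
have E0 : row 0 E = d_x0 R by rewrite rowK.
have E1 : row 1 E = U by rewrite rowK.
have E2 : row 2 E = V by rewrite rowK.
have E3 : row 3 E = V *m A by rewrite rowK.
have orthE i j : metric (row i E) (row j E) = (i == j)%:R.
  move: i j; elim/ord4P; elim/ord4P; rewrite ?E0 ?E1 ?E2 ?E3 //=;
    first [by rewrite ?mAA ?mx0 ?UA ?e0VA ?e0 ?mxE
          |by rewrite metricC ?mx0 ?UA ?e0VA ?e0 ?mxE].
have EE := orthonormal_mulmx orthE.
have EA : E^T *m selfdual_mx (d_x1 R) *m E = A.
  (* Row by row: [A] sends e_0 to e_1, e_1 to -e_0, e_2 to e_3 and e_3 to -e_2. *)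
  rewrite -mulmxA (_ : selfdual_mx (d_x1 R) *m E = E *m A).
    by rewrite mulmxA (mulmx1C EE) mul1mx.
  apply/row_matrixP; elim/ord4P; rewrite !row_mul ?E0 ?E1 ?E2 ?E3;
    rewrite mulmx_sum_row sum_ord4 !mxE /= ?E0 ?E1 ?E2 ?E3;
    rewrite ?(oppr0, scale0r, scale1r, addr0, add0r) //.
  - by rewrite -e0A -mulmxA AA mulmxN mulmx1 scaleN1r.
  - by rewrite -mulmxA AA mulmxN mulmx1 scaleN1r.
exists E => //; split=> //.
(* Orientation: det E = Pf(E^T K E) = Pf A = |U|^2 = 1. *)
by rewrite -pfaffian_congr EA pfaffian_selfdual_mx // UU ltr01.
Qed.

(** * Positive almost Hermitian structures from unit vectors *)

Definition J_of_unit U : 'End('rV[R]_4) := linfun (mulmxr (selfdual_mx U)).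

Lemma J_of_unitE U X : J_of_unit U X = X *m selfdual_mx U.
Proof. by rewrite lfunE. Qed.

Lemma J_of_unit_d_x0 U : unit_R3 U -> J_of_unit U (d_x0 R) = U.
Proof. by case=> U0 _; rewrite J_of_unitE delta_selfdual_mx. Qed.

Lemma J_of_unitK U X : unit_R3 U -> J_of_unit U (J_of_unit U X) = - X.
Proof.
by case=> U0 U1; rewrite !J_of_unitE -mulmxA selfdual_mx_sqr // mulmxN mulmx1.
Qed.

Lemma J_of_unit_almost_hermitian U : unit_R3 U -> almost_hermitian (J_of_unit U).
Proof.
move=> Uu; split=> [X Y|X]; last exact: J_of_unitK.
case: Uu => U0 U1; rewrite !J_of_unitE !metricE trmx_mul selfdual_mx_tr.
by rewrite mulNmx mulmxN -!mulmxA (mulmxA (selfdual_mx _)) selfdual_mx_sqr //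
  mulNmx mul1mx mulmxN opprK.
Qed.

(** In the frame [E] the matrix of [J] is the standard one; E^T = E^-1 turns the change of basis
    into a congruence. *)
Lemma frame_congr E J : oriented_orthonormal E -> (forall X, J (J X) = - X) ->
  J (row 0 E) = row 1 E -> J (row 2 E) = row 3 E ->
  forall X, J X = X *m (E^T *m selfdual_mx (d_x1 R) *m E).
Proof.
move=> /oriented_orthonormal_mulmx[EE _] JJ J0 J2 X.
have J1 : J (row 1 E) = - row 0 E by rewrite -J0 JJ.
have J3 : J (row 3 E) = - row 2 E by rewrite -J2 JJ.
have JE Y : J (Y *m E) = Y *m selfdual_mx (d_x1 R) *m E.
  rewrite -mulmxA !mulmx_sum_row linear_sum /=; apply: eq_bigr => k _.
  rewrite linearZ /=; congr (_ *: _); move: k.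
  elim/ord4P; rewrite row_mul mulmx_sum_row sum_ord4 !mxE /=;
    by rewrite ?(oppr0, scale0r, scale1r, scaleN1r, addr0, add0r).
have {1}-> : X = X *m E^T *m E by rewrite -mulmxA (mulmx1C EE) mulmx1.
by rewrite JE !mulmxA.
Qed.

(** The hypotheses give E A = K E, with A = [selfdual_mx U] and K standard, which is read off row by
    row. *)
Lemma J_of_unit_frame E U : E *m E^T = 1%:M ->
  E^T *m selfdual_mx (d_x1 R) *m E = selfdual_mx U ->
  [/\ J_of_unit U (row 0 E) = row 1 E, J_of_unit U (row 1 E) = - row 0 E,
      J_of_unit U (row 2 E) = row 3 E & J_of_unit U (row 3 E) = - row 2 E].
Proof.
move=> EE AE; have JE i : J_of_unit U (row i E) = row i (selfdual_mx (d_x1 R)) *m E.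
  by rewrite J_of_unitE -AE -row_mul -row_mul !mulmxA EE mul1mx.
split; rewrite JE mulmx_sum_row sum_ord4 !mxE /=;
  by rewrite ?(oppr0, scale0r, scale1r, scaleN1r, addr0, add0r).
Qed.

Lemma positive_almost_hermitianP J :
  positive_almost_hermitian J <-> exists2 U, unit_R3 U & J = J_of_unit U.
Proof.
split=> [[[_ JJ] [E oE [J0 J2]]]|[U Uu ->]].
  have [U Uu EU] := congr_oriented oE; exists U => //.
  by apply/lfunP => X; rewrite J_of_unitE -EU; apply: frame_congr.
split; first exact: J_of_unit_almost_hermitian.
have [E oE EU] := selfdual_mx_frame Uu; exists E => //.
by have [EE _] := oriented_orthonormal_mulmx oE; have [] := J_of_unit_frame EE EU.
Qed.

End Frames.

(** In terms of the common index set, [f] and [g] are both the identity, so they are mutually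
    inverse. *)
Lemma one_to_one_param (I T U : Type) (D : set I) (a : I -> T) (b : I -> U)
    (A : set T) (B : set U) (f : T -> U) (g : U -> T) :
  (forall x, A x <-> exists2 i, D i & x = a i) ->
  (forall y, B y <-> exists2 i, D i & y = b i) ->
  (forall i, D i -> f (a i) = b i) -> (forall i, D i -> g (b i) = a i) ->
  one_to_one A B f g.
Proof.
move=> AE BE fa gb.
have fAB x : A x -> B (f x).
  by move=> /AE[i Di ->]; apply/BE; exists i; rewrite ?fa.
have gBA y : B y -> A (g y).
  by move=> /BE[i Di ->]; apply/AE; exists i; rewrite ?gb.
have fK x : A x -> g (f x) = x by move=> /AE[i Di ->]; rewrite fa ?gb.
have gK y : B y -> f (g y) = y by move=> /BE[i Di ->]; rewrite gb ?fa.
split.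
- split=> // [x x' /set_mem Ax /set_mem Ax' e|y By].
    by rewrite -(fK x) // e fK.
  by exists (g y); [exact: gBA | exact: gK].
- split=> // [y y' /set_mem By /set_mem By' e|x Ax].
    by rewrite -(gK y) // e gK.
  by exists (f x); [exact: fAB | exact: fK].
- by move=> x /set_mem; exact: fK.
- by move=> y /set_mem; exact: gK.
Qed.

(** * Complexified vectors, alpha-planes and their endomorphisms *)

Section Planes.
Variable R : realType.
Implicit Types (Pi W : set 'rV[R[i]]_4) (E : 'M[R]_4) (U V X Y : 'rV[R]_4).
Implicit Types (J : 'End('rV[R]_4)).

Lemma cvec_inj : injective (@cvec R).
Proof. by move=> X Y /rowP e; apply/rowP => j; have := e j; rewrite !mxE => -[]. Qed.

Lemma unit_vector_R3P p U : unit_vector_R3 p U <-> unit_R3 U.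
Proof.
split=> [[[x /= x0 /addrI /cvec_inj <-]]|[U0 UU]] //.
by split=> //; exists U.
Qed.

Lemma cvec_addE X Y : cvec X + 'i *: cvec Y = \row_j (X 0 j +i* Y 0 j).
Proof.
apply/rowP => j; rewrite !mxE; apply/eqP; rewrite eq_complex /=.
by apply/andP; split; apply/eqP; ring.
Qed.

Lemma Re_cvec_add X Y : map_mx (@complex.Re R) (cvec X + 'i *: cvec Y) = X.
Proof. by rewrite cvec_addE; apply/rowP => j; rewrite !mxE. Qed.

Lemma Im_cvec_add X Y : map_mx (@complex.Im R) (cvec X + 'i *: cvec Y) = Y.
Proof. by rewrite cvec_addE; apply/rowP => j; rewrite !mxE. Qed.

Lemma complexify_cvec_add J X Y :
  complexify J (cvec X + 'i *: cvec Y) = cvec (J X) + 'i *: cvec (J Y).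
Proof. by rewrite /complexify Re_cvec_add Im_cvec_add. Qed.

Lemma cvec_add_inj X Y X' Y' :
  cvec X + 'i *: cvec Y = cvec X' + 'i *: cvec Y' -> X = X' /\ Y = Y'.
Proof.
move=> e; rewrite -(Re_cvec_add X Y) -{2}(Im_cvec_add X Y) e.
by rewrite Re_cvec_add Im_cvec_add.
Qed.

Lemma conj_cvec_add X Y :
  conj_vec (cvec X + 'i *: cvec Y) = cvec X + 'i *: cvec (- Y).
Proof. by rewrite !cvec_addE; apply/rowP => j; rewrite !mxE. Qed.

Lemma scale_i_cvec_add X Y :
  'i *: (cvec X + 'i *: cvec Y) = cvec (- Y) + 'i *: cvec X.
Proof.
rewrite !cvec_addE; apply/rowP => j; rewrite !mxE; apply/eqP.
by rewrite eq_complex /=; apply/andP; split; apply/eqP; ring.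
Qed.

Lemma scale_Ni_cvec_add X Y :
  - 'i *: (cvec X + 'i *: cvec Y) = cvec Y + 'i *: cvec (- X).
Proof.
rewrite !cvec_addE; apply/rowP => j; rewrite !mxE; apply/eqP.
by rewrite eq_complex /=; apply/andP; split; apply/eqP; ring.
Qed.

Lemma complex_span2P (a b v : 'rV[R[i]]_4) :
  complex_span2 a b v <-> exists z w, v = z *: a + w *: b.
Proof.
rewrite /complex_span2 /= span_cons span_seq1; split.
  move=> /memv_addP[_ /vlineP[z ->] [_ /vlineP[w ->] ->]].
  by exists z, w.
by move=> [z [w ->]]; apply: memv_add; apply: memvZ; exact: memv_line.
Qed.

(* In a J-adapted frame, X + iJX has the coordinates c_0 - i c_1 and
   c_2 - i c_3 with respect to e_0 + i e_1 and e_2 + i e_3. *)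
Lemma plane_of_J_frame E J : E *m E^T = 1%:M ->
  J (row 0 E) = row 1 E -> J (row 1 E) = - row 0 E ->
  J (row 2 E) = row 3 E -> J (row 3 E) = - row 2 E ->
  plane_of_J J = complex_span2 (cvec (row 0 E) + 'i *: cvec (row 1 E))
                               (cvec (row 2 E) + 'i *: cvec (row 3 E)).
Proof.
move=> EE J0 J1 J2 J3.
have coord (c0 c1 c2 c3 : R) :
    let X := c0 *: row 0 E + c1 *: row 1 E + c2 *: row 2 E + c3 *: row 3 E in
    cvec X + 'i *: cvec (J X) =
    (c0 +i* - c1) *: (cvec (row 0 E) + 'i *: cvec (row 1 E)) +
    (c2 +i* - c3) *: (cvec (row 2 E) + 'i *: cvec (row 3 E)).
  rewrite /= !linearD !linearZ /= J0 J1 J2 J3 !cvec_addE.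
  apply/rowP => j; rewrite !mxE; apply/eqP.
  by rewrite eq_complex /=; apply/andP; split; apply/eqP; ring.
apply/seteqP; split=> v.
  move=> [X _ <-]; apply/complex_span2P.
  have -> : X = X *m E^T *m E by rewrite -mulmxA (mulmx1C EE) mulmx1.
  rewrite mulmx_sum_row sum_ord4 coord.
  by do 2 eexists.
move=> /complex_span2P[[c0 c1] [[c2 c3] ->]].
by rewrite -(opprK c1) -(opprK c3) -coord; eexists.
Qed.

(** Any oriented frame is adapted to the [J_of_unit U] it induces, and every [U] admits such a
    frame; [plane_of_J_frame] identifies the span. *)
Lemma alpha_planeP Pi : alpha_plane Pi <->
  exists2 U, unit_R3 U & Pi = plane_of_J (J_of_unit U).
Proof.
split=> [[E oE ->]|[U Uu ->]].
  have [U Uu EU] := congr_oriented oE; exists U => //.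
  have [EE _] := oriented_orthonormal_mulmx oE.
  by have [J0 J1 J2 J3] := J_of_unit_frame EE EU; rewrite (plane_of_J_frame EE).
have [E oE EU] := selfdual_mx_frame Uu; exists E => //.
have [EE _] := oriented_orthonormal_mulmx oE.
by have [J0 J1 J2 J3] := J_of_unit_frame EE EU; rewrite (plane_of_J_frame EE).
Qed.

(** Real parts of the -i condition at X + i J_U X give J X = J_U X; conversely J_U^2 = -1 gives both
    eigenvalue equations. *)
Lemma eigen_mi_piP U J : unit_R3 U ->
  eigen_mi_pi (plane_of_J (J_of_unit U)) J <-> J = J_of_unit U.
Proof.
move=> Uu; split=> [[eigen _]|->].
  apply/lfunP => X.
  have := eigen (cvec X + 'i *: cvec (J_of_unit U X)).
  rewrite complexify_cvec_add scale_Ni_cvec_add => /(_ _)/cvec_add_inj[] //.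
  by exists X.
split=> [_ [X _ <-]|_ [_ [X _ <-] <-]].
  by rewrite complexify_cvec_add scale_Ni_cvec_add J_of_unitK.
by rewrite conj_cvec_add complexify_cvec_add scale_i_cvec_add linearN /=
  J_of_unitK // !opprK.
Qed.

(** * The Minkowski slice and null directions *)

Lemma wick_inj : injective (@wick R).
Proof.
move=> x y /rowP e; apply/rowP => j; have := e j; rewrite !mxE.
by case: ifP => _ [] *; lra.
Qed.

Lemma wickZ (r : R) x : wick (r *: x) = r%:C *: wick x.
Proof.
apply/rowP => j; rewrite !mxE; case: ifP => _; apply/eqP;
  by rewrite eq_complex /=; apply/andP; split; apply/eqP; ring.
Qed.

Lemma d_t_addE U : unit_R3 U -> d_t R + cvec U = wick (d_x0 R + U).
Proof.
move=> [U0 _]; apply/rowP => j; rewrite !mxE.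
case: (j =P 0) => [->|_]; rewrite ?U0 /=; apply/eqP;
  by rewrite eq_complex /=; apply/andP; split; apply/eqP; ring.
Qed.

Lemma tangent_slice_M4 (p v : 'rV[R[i]]_4) :
  tangent p (slice_M4 p) v <-> exists x, v = wick x.
Proof.
split=> [[x _ /addrI <-]|[x ->]]; first by exists x.
by exists x.
Qed.

Lemma direction_of_vectorP U v : unit_R3 U ->
  direction_of_vector U v <-> exists r : R, v = wick (r *: (d_x0 R + U)).
Proof.
move=> Uu; rewrite /direction_of_vector d_t_addE //.
by split=> [[r _ <-]|[r ->]]; exists r; rewrite ?wickZ.
Qed.

(** Both generators have time component 1, so the scalar relating them is 1. Inclusion is the form
    needed for [direction_sub_plane]. *)
Lemma direction_of_vector_inj U V : unit_R3 U -> unit_R3 V ->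
  direction_of_vector U `<=` direction_of_vector V -> U = V.
Proof.
move=> Uu Vu UV.
have /UV /direction_of_vectorP : direction_of_vector U (wick (d_x0 R + U)).
  by apply/direction_of_vectorP => //; exists 1; rewrite scale1r.
move=> /(_ Vu)[r /wick_inj /rowP e].
have r1 : r = 1.
  have := e 0; rewrite !mxE /=.
  by case: Uu Vu => -> _ [-> _]; rewrite !addr0 mulr1 => <-.
by apply: (addrI (d_x0 R)); apply/rowP => j; rewrite e r1 scale1r.
Qed.

Lemma null_directionP (p : 'rV[R[i]]_4) W : null_direction p W <->
  exists2 U, unit_R3 U & W = direction_of_vector U.
Proof.
split=> [[w [/tangent_slice_M4[x ->]]]|[U Uu ->]].
  rewrite metric_wick => x_n0 [] nx ->.
  (* With zero time component, nullness would kill the spatial part as well. *)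
  have x0 : x 0 0 != 0.
    apply: contraNneq x_n0 => x0; move: nx; rewrite x0 expr0n oppr0 add0r.
    move=> /eqP; rewrite !paddr_eq0 ?addr_ge0 ?sqr_ge0 // !sqrf_eq0.
    move=> /andP[/andP[/eqP x1 /eqP x2] /eqP x3].
    suff -> : x = 0 by apply/eqP/rowP => j; rewrite !mxE; case: ifP; rewrite ?mulr0.
    by apply/rowP; elim/ord4P; rewrite mxE.
  (* Rescaling to time component 1 leaves [U] as spatial part, of norm 1 by nullness. *)
  pose U := (x 0 0)^-1 *: x - d_x0 R.
  have Uu : unit_R3 U.
    rewrite /unit_R3 /metric sum_ord4 !mxE /= !mulVf // !subrr.
    split=> //; rewrite !subr0 mulr0 add0r.
    transitivity ((x 0 0)^-1 ^+ 2 * (x 0 1 ^+ 2 + x 0 2 ^+ 2 + x 0 3 ^+ 2)).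
      by ring.
    rewrite (_ : _ + _ = x 0 0 ^+ 2); first by rewrite exprVn mulVf // sqrf_eq0.
    by lra.
  exists U => //.
  have xE : x = x 0 0 *: (d_x0 R + U).
    by rewrite addrC subrK scalerA divff // scale1r.
  apply/seteqP; split=> v.
    move=> [r _ <-]; apply/direction_of_vectorP => //; exists (r * x 0 0).
    by rewrite -scalerA -xE wickZ.
  move=> /direction_of_vectorP[//|r ->]; exists (r / x 0 0) => //.
  by rewrite -wickZ {2}xE scalerA divfK.
exists (wick (d_x0 R + U)); case: (Uu) => U0 UU; split.
- by apply/tangent_slice_M4; eexists.
- apply/eqP => /rowP/(_ 0); rewrite !mxE /= U0 => -[] /=; lra.
- rewrite metric_wick !mxE /= U0; move: UU; rewrite /metric sum_ord4 U0 => UU.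
  by congr (_%:C); move: UU; lra.
- by rewrite /direction_of_vector d_t_addE.
Qed.

Lemma direction_of_plane_J_of_unit (p : 'rV[R[i]]_4) U : unit_R3 U ->
  direction_of_plane p (plane_of_J (J_of_unit U)) = direction_of_vector U.
Proof.
move=> Uu; set J := J_of_unit U.
have JU : J U = - d_x0 R by rewrite -{1}(J_of_unit_d_x0 Uu) J_of_unitK.
(* The real part of a Minkowski vector is spatial; its imaginary part is a multiple of [d_x0]. *)
have wickE y : wick y = cvec (y - y 0 0 *: d_x0 R) + 'i *: cvec (- (y 0 0 *: d_x0 R)).
  rewrite cvec_addE; apply/rowP; elim/ord4P; rewrite !mxE /=; apply/eqP;
  by rewrite eq_complex /=; apply/andP; split; apply/eqP; ring.
apply/seteqP; split=> v.
  move=> [[X _ <-] /tangent_slice_M4[y]].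
  rewrite wickE => /cvec_add_inj[XE JX].
  apply/direction_of_vectorP => //; exists (y 0 0).
  (* Applying [J] to the imaginary part, with J d_x0 = U, gives X = y_0 U. *)
  have : J (J X) = - (y 0 0 *: U).
    by rewrite JX linearN linearZ /= J_of_unit_d_x0.
  rewrite J_of_unitK // => /oppr_inj XU.
  by rewrite JX XE -wickE; congr wick; rewrite scalerDr -XU XE addrC subrK.
move=> /direction_of_vectorP[//|r ->]; split; last first.
  by apply/tangent_slice_M4; eexists.
exists (r *: U) => //; rewrite wickE linearZ /= JU !mxE /=.
case: Uu => -> _; rewrite addr0 mulr1 scalerN; congr (cvec _ + _).
by rewrite scalerDr addrC addKr.
Qed.

(** The direction of [U] is real Minkowski, so it lies in the Minkowski part of the plane of [V],
    which is the direction of [V]. *)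
Lemma direction_sub_plane U V : unit_R3 U -> unit_R3 V ->
  direction_of_vector U `<=` plane_of_J (J_of_unit V) -> U = V.
Proof.
move=> Uu Vu UV; apply: direction_of_vector_inj => // v Uv.
(* The base point 0 is an arbitrary choice. *)
rewrite -(direction_of_plane_J_of_unit 0) //; split; first exact: UV.
by move: Uv => /direction_of_vectorP[//|r ->]; apply/tangent_slice_M4; eexists.
Qed.

Lemma direction_of_vector_sub U : unit_R3 U ->
  direction_of_vector U `<=` plane_of_J (J_of_unit U).
Proof. by move=> Uu; rewrite -(direction_of_plane_J_of_unit 0) // => v []. Qed.

End Planes.

(** * Assembling the correspondences through the parameter U *)

Theorem propositionS5p1 (R : realType) (p : 'rV[R[i]]_4) :
  exists (J_of_plane : set 'rV[R[i]]_4 -> 'End('rV[R]_4))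
         (J_of_vector : 'rV[R]_4 -> 'End('rV[R]_4))
         (vector_of_direction : set 'rV[R[i]]_4 -> 'rV[R]_4)
         (plane_of_direction : set 'rV[R[i]]_4 -> set 'rV[R[i]]_4),
  [/\ (* the maps given by descriptions are the unique such objects *)
      [/\ forall Pi, alpha_plane Pi ->
            unique (fun J => eigen_mi_pi Pi J) (J_of_plane Pi),
          forall U, unit_vector_R3 p U ->
            unique (fun J => positive_almost_hermitian J /\ J (d_x0 R) = U)
                   (J_of_vector U),
          forall W, null_direction p W ->
            unique (fun U => unit_vector_R3 p U /\
                             W = real_span (d_t R + cvec U))
                   (vector_of_direction W)
        & forall W, null_direction p W ->
            unique (fun Pi => alpha_plane Pi /\ W `<=` Pi)
                   (plane_of_direction W)],
      (* they give the four one-to-one correspondences *)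
      [/\ one_to_one (@alpha_plane R) (@positive_almost_hermitian R)
                     J_of_plane (@plane_of_J R),
          one_to_one (@positive_almost_hermitian R) (unit_vector_R3 p)
                     (@vector_of_J R) J_of_vector,
          one_to_one (unit_vector_R3 p) (null_direction p)
                     (@direction_of_vector R) vector_of_direction
        & one_to_one (@alpha_plane R) (null_direction p)
                     (direction_of_plane p) plane_of_direction]
    & (* the correspondences are compatible with each other *)
      forall Pi, alpha_plane Pi ->
        direction_of_vector (vector_of_J (J_of_plane Pi)) =
        direction_of_plane p Pi].
Proof.
(* The parameter is recovered by choice, with default 0 off the families; [planeK] and [directionK]
   show that it is the original [U]. *)
pose unit_of_plane Pi := xget 0
  [set U : 'rV[R]_4 | unit_R3 U /\ Pi = plane_of_J (J_of_unit U)].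
pose unit_of_direction W := xget 0
  [set U : 'rV[R]_4 | unit_R3 U /\ W = direction_of_vector U].
have planeK U : unit_R3 U -> unit_of_plane (plane_of_J (J_of_unit U)) = U.
  move=> Uu; apply: xget_unique => // V [Vu UV].
  apply: direction_sub_plane => //; rewrite UV.
  exact: direction_of_vector_sub.
have directionK U : unit_R3 U -> unit_of_direction (direction_of_vector U) = U.
  move=> Uu; apply: xget_unique => // V [Vu UV].
  by apply: direction_of_vector_inj => //; rewrite UV.
(* Unit vectors are parametrized by themselves, to fit [one_to_one_param]. *)
have unitP U : unit_vector_R3 p U <-> exists2 V, unit_R3 V & U = V.
  rewrite unit_vector_R3P; split=> [Uu|[V Vu ->]] //; by exists U.
exists (fun Pi => J_of_unit (unit_of_plane Pi)), (@J_of_unit R),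
  unit_of_direction, (fun W => plane_of_J (J_of_unit (unit_of_direction W))).
split; [split|split|].
- move=> _ /alpha_planeP[U Uu ->]; rewrite planeK //.
  by split=> [|J /eigen_mi_piP->//]; apply/eigen_mi_piP.
- move=> U /unit_vector_R3P Uu; split.
    by split; [apply/positive_almost_hermitianP; exists U|exact: J_of_unit_d_x0].
  move=> _ [/positive_almost_hermitianP[V Vu ->]].
  by rewrite J_of_unit_d_x0 // => ->.
- move=> _ /null_directionP[U Uu ->]; rewrite directionK //; split.
    by split=> //; apply/unit_vector_R3P.
  move=> V [/unit_vector_R3P Vu UV]; apply: direction_of_vector_inj => //.
  by rewrite UV.
- move=> _ /null_directionP[U Uu ->]; rewrite directionK //; split.
    by split; [apply/alpha_planeP; exists U | exact: direction_of_vector_sub].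
  move=> _ [/alpha_planeP[V Vu ->] UV].
  by rewrite (direction_sub_plane Uu Vu UV).
- apply: one_to_one_param (@alpha_planeP R) (@positive_almost_hermitianP R) _ _.
    by move=> U Uu; rewrite planeK.
  by [].
- apply: one_to_one_param (@positive_almost_hermitianP R) unitP _ _ => //.
  exact: J_of_unit_d_x0.
- exact: one_to_one_param unitP (@null_directionP R p) _ _.
- apply: one_to_one_param (@alpha_planeP R) (@null_directionP R p) _ _.
    exact: direction_of_plane_J_of_unit.
  by move=> U Uu; rewrite directionK.
- move=> _ /alpha_planeP[U Uu ->].
  by rewrite planeK // /vector_of_J J_of_unit_d_x0 // direction_of_plane_J_of_unit.
Qed.
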